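(* Let $P$ be a finite bounded graded rank-uniform poset of rank $3$. Suppose that, for every ordering $(x_1,x_2,\ldots,x_n)$ of the atoms of $P$, $$\operatorname{icov}(x_i)\neq\varnothing\qquad\text{for every }2\leq i\leq n.$$ Then $P$ is UMEL-shellable.
   Context: Let $P$ be a finite graded bounded poset with rank function $\mathrm{rk}$, minimum $\hat 0$ and maximum $\hat 1$. Write $s\lessdot t$ if $t$ covers $s$, and let $\mathcal{E}(P)$ be the set of pairs $(s,t)$ with $s\lessdot t$. Atoms are the elements of rank $1$. Rank-uniform poset (no labeling): for $s\in P$ and $k\ge 0$, $W_k(s)$ is the number of elements of rank $k+\mathrm{rk}(s)$ that are above $s$ (i.e. $\geqslant s$). $P$ is rank-uniform if $W_k(s)=W_k(t)$ for all $s,t\in P$ of the same rank and all positive integers $k$. The set $\operatorname{icov}(x_i)$: given an ordering $(x_1,\dots,x_n)$ of all the atoms of $P$ (rank $3$), for $i\ge 2$, $\operatorname{icov}(x_i)$ is the set of rank-$2$ elements $y$ covering $x_i$ that also cover at least one earlier atom $x_j$ with $j<i$ (equivalently, the covers of $x_i$ that are already present when the atoms $x_1,\dots,x_{i-1}$ and all of their covers have been inserted). An edge labeling is a map $\lambda:\mathcal{E}(P)\to\Lambda$, where $\Lambda$ is a totally ordered set (order $\vartriangleleft$). A maximal chain $s=u_0\lessdot u_1\lessdot\cdots\lessdot u_k=t$ of the interval $[s,t]$ has label word $\lambda(u_0,u_1)\cdots\lambda(u_{k-1},u_k)$. EL-labeling: $\lambda$ is an EL-labeling if for all $s\leqslant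 t$ in $P$ there is a unique maximal chain of $[s,t]$ whose label word is weakly increasing (as the rank increases), and this chain's label word is lexicographically minimal among the label words of all maximal chains of $[s,t]$. An EL-labeled poset is a pair $(P,\lambda)$ with $\lambda$ an EL-labeling. For an EL-labeled poset $(P,\lambda)$ and $s\in P$, let $\lambda_1\vartriangleleft\cdots\vartriangleleft\lambda_\ell$ be the distinct labels of the covering relations $s\lessdot t$ above $s$. - Width: $\omega_s(i)=|\{t: s\lessdot t,\ \lambda(s,t)=\lambda_i\}|$ for $1\le i\le\ell$, and $\omega_s(i)=0$ for $i>\ell$. - Index: for $s\lessdot t$, $\mathrm{Ind}(s,t)$ is the unique $i\in[\ell]$ with $\lambda_i=\lambda(s,t)$. - Descents: for $s\lessdot t$, if $\lambda'_1\vartriangleleft\cdots\vartriangleleft\lambda'_{\ell'}$ are the distinct labels of the covering relations above $t$, then $\mathrm{des}_s(t)=|\{j\in[\ell']:\lambda'_j\vartriangleleft\lambda(s,t)\}|$. Rank-uniform labeled poset: an EL-labeled poset $(P,\lambda)$ such that (uniform width) $\omega_s(i)=\omega_{s'}(i)$ for all $s,s'$ of the same rank and all $i\ge1$, and (uniform descent) $\mathrm{des}_s(t)=\mathrm{des}_{s'}(t')$ whenever $s,s'$ have the same rank, $s\lessdot t$, $s'\lessdot t'$ and $\mathrm{Ind}(s,t)=\mathrm{Ind}(s',t')$. Monotonic: for a rank-uniform labeled poset and $0\le k\le \mathrm{rk}(P)-1$, let $\ell_k$ be the number of distinct labels above any element of rank $k$, and for $i\in[\ell_k]$ let $\mathrm{des}_k(i)$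 be the common value of $\mathrm{des}_s(t)$ over all $s\lessdot t$ with $\mathrm{rk}(s)=k$, $\mathrm{Ind}(s,t)=i$. The labeled poset is monotonic if for every such $k$ the function $\mathrm{des}_k$ is weakly increasing on $[\ell_k]$. UMEL-shellable: $P$ is UMEL-shellable if it admits an EL-labeling $\lambda$ such that $(P,\lambda)$ is a monotonic rank-uniform labeled poset. *)

(* Defs.v *)
From HB Require Import structures.
From mathcomp Require Import all_boot all_order.

Set Implicit Arguments.
Unset Strict Implicit.
Unset Printing Implicit Defensive.

Import Order.TTheory.
Local Open Scope order_scope.

Definition covered d (P : finPOrderType d) (s t : P) : bool :=
  (s < t) && [forall u, ~~ ((s < u) && (u < t))].

(* On a finite bounded poset such a function exists iff the poset is graded,  *)
(* and it is then unique.                                                     *)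
Definition is_rank d (P : finTBPOrderType d) (rk : P -> nat) : Prop :=
  rk \bot = 0%N /\ forall s t : P, covered s t -> rk t = (rk s).+1.

Definition W d (P : finTBPOrderType d) (rk : P -> nat) (k : nat) (s : P) : nat :=
  #|[set t : P | (rk t == k + rk s)%N && (s <= t)]|.

Definition rank_uniform d (P : finTBPOrderType d) (rk : P -> nat) : Prop :=
  forall (s t : P) (k : nat), rk s = rk t -> (0 < k)%N -> W rk k s = W rk k t.

Definition atom_ordering d (P : finTBPOrderType d) (rk : P -> nat)
    (xs : seq P) : Prop :=
  uniq xs /\ xs =i [pred x | rk x == 1%N].

(* Positions are counted from 0: [icov rk xs i] is icov(x_(i+1)).             *)
Definition icov d (P : finTBPOrderType d) (rk : P -> nat)
    (xs : seq P) (i : nat) : {set P} :=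
  [set y : P | [&& rk y == 2%N, covered (nth \bot xs i) y
                 & has (fun x => covered x y) (take i xs)]].

(* The chain s = u_0 <. u_1 <. ... <. u_k = t is represented by the sequence  *)
(* [:: u_1; ...; u_k].                                                        *)
Definition maximal_chain d (P : finPOrderType d) (s t : P) (c : seq P) : bool :=
  path (@covered d P) s c && (last s c == t).

(* An edge labeling is a function on all pairs of elements; only its values   *)
(* on covering pairs are ever used.                                           *)
Definition label_word d (P : finPOrderType d) d' (L : orderType d')
    (lam : P -> P -> L) (s : P) (c : seq P) : seq L :=
  pairmap lam s c.

Definition EL_labeling d (P : finPOrderType d) d' (L : orderType d')
    (lam : P -> P -> L) : Prop :=
  forall s t : P, s <= t ->
  exists c : seq P,
    [/\ maximal_chain s t c,
        sorted <=%O (label_word lam s c),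
        forall c' : seq P, maximal_chain s t c' ->
          sorted <=%O (label_word lam s c') -> c' = c
      & forall c' : seq P, maximal_chain s t c' ->
          (label_word lam s c : seqlexi L) <= label_word lam s c'].

Definition labels_above d (P : finPOrderType d) d' (L : orderType d')
    (lam : P -> P -> L) (s : P) : seq L :=
  sort <=%O (undup [seq lam s t | t <- enum P & covered s t]).

(* The indices i of [width] and [ind] start from 1.                           *)
Definition width d (P : finPOrderType d) d' (L : orderType d')
    (lam : P -> P -> L) (s : P) (i : nat) : nat :=
  if (1 <= i <= size (labels_above lam s))%N then
    #|[set t : P | covered s t & onth (labels_above lam s) i.-1 == Some (lam s t)]|
  else 0%N.

Definition ind d (P : finPOrderType d) d' (L : orderType d')
    (lam : P -> P -> L) (s t : P) : nat :=
  (index (lam s t) (labels_above lam s)).+1.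

Definition des d (P : finPOrderType d) d' (L : orderType d')
    (lam : P -> P -> L) (s t : P) : nat :=
  count (fun l => l < lam s t) (labels_above lam t).

Definition rank_uniform_labeled d (P : finTBPOrderType d) (rk : P -> nat)
    d' (L : orderType d') (lam : P -> P -> L) : Prop :=
  [/\ EL_labeling lam,
      forall (s s' : P) (i : nat), rk s = rk s' -> (1 <= i)%N ->
        width lam s i = width lam s' i
    & forall s t s' t' : P, rk s = rk s' -> covered s t -> covered s' t' ->
        ind lam s t = ind lam s' t' -> des lam s t = des lam s' t'].

(* For a rank-uniform labeled poset the values of [num_labels] and [des_rank] *)
(* do not depend on the element, resp. covering pair, that is picked.         *)
Definition num_labels d (P : finTBPOrderType d) (rk : P -> nat)
    d' (L : orderType d') (lam : P -> P -> L) (k : nat) : nat :=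
  if [pick s : P | rk s == k] is Some s then size (labels_above lam s) else 0%N.

Definition des_rank d (P : finTBPOrderType d) (rk : P -> nat)
    d' (L : orderType d') (lam : P -> P -> L) (k i : nat) : nat :=
  if [pick e : P * P | [&& rk e.1 == k, covered e.1 e.2 & ind lam e.1 e.2 == i]]
    is Some e then des lam e.1 e.2 else 0%N.

Definition monotonic d (P : finTBPOrderType d) (rk : P -> nat)
    d' (L : orderType d') (lam : P -> P -> L) : Prop :=
  forall k i j : nat, (k < rk \top)%N ->
    (1 <= i)%N -> (i <= j)%N -> (j <= num_labels rk lam k)%N ->
    (des_rank rk lam k i <= des_rank rk lam k j)%N.

Definition UMEL_shellable d (P : finTBPOrderType d) (rk : P -> nat) : Prop :=
  exists (d' : Order.disp_t) (L : orderType d') (lam : P -> P -> L),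
    rank_uniform_labeled rk lam /\ monotonic rk lam.

(* Main.v *)
Require Import Defs.
From mathcomp Require Import all_boot all_order zify.

(** The EL condition on an interval of rank two with middle elements v says
    that exactly one of them is an ascent, and that it carries the smallest
    lower label. Number the atoms x_0, x_1, ... and give them increasing labels
    at the bottom. Suppose that every edge into the top has label 0. Then the
    interval below a rank-two element y is as required if the first atom below
    y gives an ascent and every later atom x_j gives a descent, so the edge from
    x_j to y must be labeled below x_j exactly when y lies in icov(x_j). The
    interval above an atom is as required if one edge leaving the atom, and only
    one, has label 0. For j > 0 that edge must also be a descent with respect to
    the label of x_j, since otherwise the whole poset would have a second
    increasing chain: so it has to lead into icov(x_j), and this is where
    icov(x_j) must be nonempty. [umel_label] is a labeling by natural numbers
    meeting these demands, in which moreover the edges leaving any given element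
    have distinct labels ([umel_label_EL]).

    Because of this distinctness, all widths are 1 up to the number of covers,
    so uniform width is the case k = 1 of rank-uniformity ([width_inj]). Descent
    numbers become cardinals ([des_inj]): above an atom they are 0 for the edge
    of index 1 and 1 for all others, above a coatom they are 0, and at the
    bottom the descent number of x_j is the size of icov(x_j). Uniform descent
    and monotonicity are therefore both instances of a single statement,
    [des_mono], as soon as the size of icov(x_j) weakly increases with j.

    Such an order of the atoms is obtained greedily, always appending an atom
    whose icov is smallest ([greedy_sequence]). The set icov(x) can only grow
    when more atoms precede x, so if i <= j then x_j would have had at position
    i an icov no larger than its actual one, and x_i was preferred to it. *)

Set Implicit Arguments.
Unset Strict Implicit.
Unset Printing Implicit Defensive.

Import Order.TTheory.

(** * Greedy enumerations *)

(** Appending an element of least cost each time makes the sequence of costs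
    weakly increasing when costs only grow with the prefix: the element that
    comes at position j was a candidate at every earlier position i, at a cost
    bounded by the one it has at j. *)
Lemma greedy_sequence (T : eqType) (f : seq T -> T -> nat) (r : seq T)
    (f_mono : forall p q x, {subset p <= q} -> f p x <= f q x) :
  exists2 s : seq T, perm_eq s r &
    forall x0 i j, i <= j < size s ->
      f (take i s) (nth x0 s i) <= f (take j s) (nth x0 s j).
Proof.
suff: exists2 s, perm_eq s r & forall x0 i x, i < size s -> x \in drop i s ->
    f (take i s) (nth x0 s i) <= f (take i s) x.
  case=> s s_r s_greedy; exists s => // x0 i j /andP[le_ij lt_js].
  apply: (@leq_trans (f (take i s) (nth x0 s j))).
    apply: s_greedy; first exact: leq_ltn_trans lt_js.
    rewrite -{1}(subnKC le_ij) -nth_drop mem_nth // size_drop.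
    by rewrite ltn_sub2r // (leq_ltn_trans le_ij).
  by apply: f_mono; rewrite -(take_takel s le_ij); apply: mem_take.
(* The prefix p already placed is a parameter, so that the induction can peel
   the sequence from its head. *)
suff build n p r' : size r' = n -> exists2 s, perm_eq s r' &
    forall x0 i x, i < size s -> x \in drop i s ->
      f (p ++ take i s) (nth x0 s i) <= f (p ++ take i s) x.
  by have [s ? ?] := build _ [::] _ (erefl (size r)); exists s.
elim: n => [|n IHn] in p r' *; first by move/size0nil->; exists [::].
move=> size_r'.
have [a a_r' a_min] : exists2 a, a \in r' & forall x, x \in r' -> f p a <= f p x.
  case: r' size_r' => // b r' _; elim: r' => [|c r' [a a_in a_min]].
    by exists b; rewrite ?mem_head // => x; rewrite inE => /eqP->.
  have [le_ac|lt_ca] := leqP (f p a) (f p c).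
    exists a; first by move: a_in; rewrite !inE => /orP[] ->; rewrite ?orbT.
    move=> x; rewrite !inE orbCA => /orP[/eqP->//|x_in].
    by apply: a_min; rewrite inE.
  exists c; first by rewrite !inE eqxx orbT.
  move=> x; rewrite !inE orbCA => /orP[/eqP->//|x_in].
  by apply: leq_trans (ltnW lt_ca) _; apply: a_min; rewrite inE.
have [|s s_r' s_greedy] := IHn (rcons p a) (rem a r').
  by rewrite size_rem // size_r'.
have as_r' : perm_eq (a :: s) r'.
  by rewrite perm_sym (perm_trans (perm_to_rem a_r')) // perm_cons perm_sym.
exists (a :: s) => // x0 [|i] x.
  by rewrite take0 drop0 cats0 /= => _; rewrite (perm_mem as_r'); apply: a_min.
by rewrite /= -cat_rcons; apply: s_greedy.
Qed.

Local Open Scope order_scope.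

(** * Rank functions of finite bounded posets *)

Section Rank.

Variables (d : Order.disp_t) (P : finTBPOrderType d) (rk : P -> nat).
Hypothesis rk_rank : is_rank rk.
Implicit Types s t u v : P.

Lemma covered_lt s t : covered s t -> s < t.
Proof. by case/andP. Qed.

Lemma lt_covered s t : s < t -> exists2 u, covered s u & u <= t.
Proof.
move=> lt_st; have t_st : (s < t <= t) by rewrite lt_st lexx.
case: (@arg_minnP _ t (fun u => s < u <= t) (fun u => #|[set v | v < u]|) t_st).
move=> u /andP[lt_su le_ut] u_min; exists u => //.
rewrite /covered lt_su; apply/forallP => v; apply/negP => /andP[lt_sv lt_vu].
have := u_min v; rewrite lt_sv (le_trans (ltW lt_vu) le_ut) => /(_ isT).
rewrite leqNgt => /negP; apply; apply/proper_card/properP; split.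
  by apply/subsetP => w; rewrite !inE => /lt_trans; apply.
by exists v; rewrite !inE ?ltxx.
Qed.

Lemma rk_lt s t : s < t -> (rk s < rk t)%N.
Proof.
have [n] := ubnP #|[set v | s < v]|; elim: n => // n IHn in s t *.
move=> le_n lt_st; have [u su le_ut] := lt_covered lt_st.
have [_ /(_ _ _ su) rk_u] := rk_rank.
move: le_ut; rewrite le_eqVlt => /predU1P[<-|lt_ut]; first by rewrite rk_u.
apply: ltn_trans (IHn u t _ lt_ut); first by rewrite rk_u.
move: le_n; rewrite ltnS; apply: leq_trans.
apply/proper_card/properP; split.
  apply/subsetP => w; rewrite !inE; apply: lt_trans; exact: covered_lt.
by exists u; rewrite !inE ?ltxx ?covered_lt.
Qed.

Lemma coveredE s t : covered s t = (rk t == (rk s).+1) && (s <= t).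
Proof.
apply/idP/andP => [st|[/eqP rk_t]].
  by case: rk_rank => _ /(_ _ _ st)->; rewrite (ltW (covered_lt st)).
rewrite le_eqVlt => /predU1P[st|lt_st].
  by move/eqP: rk_t; rewrite st -[X in X == _]addn0 -addn1 eqn_add2l.
rewrite /covered lt_st; apply/forallP => u; apply/negP => /andP[/rk_lt + /rk_lt].
by rewrite rk_t; lia.
Qed.

Lemma W1E s : W rk 1 s = #|[set t | covered s t]|.
Proof. by apply: eq_card => t; rewrite !inE coveredE add1n. Qed.

Lemma rk_eq0 s : (rk s == 0%N) = (s == \bot).
Proof.
apply/idP/eqP => [|->]; last by case: rk_rank => ->.
by have := le0x s; rewrite le_eqVlt => /predU1P[<-//|/rk_lt]; case: (rk s).
Qed.

Lemma rk_le_top s : (rk s <= rk \top)%N.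
Proof.
by have := lex1 s; rewrite le_eqVlt => /predU1P[<-//|/rk_lt/ltnW].
Qed.

Lemma rk_eq_top s : rk s = rk \top -> s = \top.
Proof.
move=> rk_s; have := lex1 s; rewrite le_eqVlt => /predU1P[//|/rk_lt].
by rewrite rk_s ltnn.
Qed.

Lemma maximal_chain_rk s t c : maximal_chain s t c -> rk t = (rk s + size c)%N.
Proof.
case/andP=> + /eqP<-; elim: c s => [|u c IHc] s /=; first by rewrite addn0.
by case/andP=> + /IHc->; rewrite coveredE => /andP[/eqP-> _]; rewrite addSnnS.
Qed.

End Rank.

(** * Labelings that separate the covers of an element *)

Section LabelsAbove.

Variables (d : Order.disp_t) (P : finPOrderType d).
Variables (d' : Order.disp_t) (L : orderType d') (lam : P -> P -> L) (s : P).

Lemma labels_aboveP l :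
  reflect (exists2 t, covered s t & l = lam s t) (l \in labels_above lam s).
Proof.
rewrite mem_sort mem_undup; apply: (iffP mapP) => [[t]|[t st ->]].
  by rewrite mem_filter => /andP[st _] ->; exists t.
by exists t; rewrite // mem_filter st mem_enum.
Qed.

Hypothesis lam_inj : {in covered s &, injective (lam s)}.

Lemma count_labels_above (a : pred L) :
  count a (labels_above lam s) = #|[set t | covered s t & a (lam s t)]|.
Proof.
rewrite count_sort undup_id; last first.
  rewrite map_inj_in_uniq ?filter_uniq ?enum_uniq -?enumT ?enum_uniq // => t u.
  by rewrite !mem_filter => /andP[st _] /andP[su _]; apply: lam_inj.
rewrite count_map count_filter cardE -size_filter /enum_mem.
congr size; rewrite -filter_predI; apply: eq_filter => t.
by rewrite /= !inE andbT andbC.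
Qed.

Lemma size_labels_above : size (labels_above lam s) = #|[set t | covered s t]|.
Proof.
rewrite -count_predT count_labels_above.
by apply: eq_card => t; rewrite !inE andbT.
Qed.

(** Each label is carried by one cover, so the widths at s form the sequence
    1, ..., 1, 0, 0, ... and depend on the number of covers of s only. *)
Lemma width_inj i : width lam s i = (1 <= i <= #|[set t | covered s t]|)%N.
Proof.
rewrite /width size_labels_above; case: ifP => // /andP[i_gt0 le_i].
have lt_i : (i.-1 < size (labels_above lam s))%N.
  by rewrite size_labels_above prednK.
move: lt_i; rewrite -onthTE; case def_l: (onth _ _) => [l|//] _.
have /labels_aboveP[t0 st0 def_t0] : l \in labels_above lam s.
  by rewrite -(@onth_nth _ (lam s s) _ _ _ def_l) mem_nth // -onthTE def_l.
transitivity #|[set t0]|; last by rewrite cards1.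
rewrite def_t0; apply: eq_card => t.
rewrite !inE; apply/andP/eqP => [[st /eqP[/esym e]]|->]; last by rewrite eqxx.
exact: lam_inj e.
Qed.

(** Counting smaller covers makes indices above different elements comparable
    without handling the sorted lists of labels. *)
Lemma ind_inj t : covered s t ->
  ind lam s t = #|[set u | covered s u & lam s u < lam s t]|.+1.
Proof.
move=> st; have l_in : lam s t \in labels_above lam s.
  by apply/labels_aboveP; exists t.
rewrite -(count_labels_above (fun l => l < lam s t)) /ind; congr _.+1.
rewrite -[in RHS](nth_index (lam s s) l_in) count_lt_nth ?index_mem //.
by rewrite lt_sorted_uniq_le sort_uniq undup_uniq (sort_sorted le_total).
Qed.

End LabelsAbove.

Lemma des_inj d (P : finPOrderType d) d' (L : orderType d') (lam : P -> P -> L)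
    (s t : P) : {in covered t &, injective (lam t)} ->
  des lam s t = #|[set u | covered t u & lam t u < lam s t]|.
Proof. by move=> /count_labels_above; apply. Qed.

(** * The EL condition on short intervals *)

Section EL.

Variables (d : Order.disp_t) (P : finTBPOrderType d) (rk : P -> nat).
Hypothesis rk_rank : is_rank rk.
Variables (d' : Order.disp_t) (L : orderType d') (lam : P -> P -> L).

Definition EL_interval (s t : P) : Prop := exists c : seq P,
    [/\ maximal_chain s t c,
        sorted <=%O (label_word lam s c),
        forall c' : seq P, maximal_chain s t c' ->
          sorted <=%O (label_word lam s c') -> c' = c
      & forall c' : seq P, maximal_chain s t c' ->
          (label_word lam s c : seqlexi L) <= label_word lam s c'].

Lemma EL_interval_short s t :
  s <= t -> (rk t <= (rk s).+1)%N -> EL_interval s t.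
Proof.
rewrite le_eqVlt => /predU1P[<- _|lt_st le_rk].
  have nil_chain c' : maximal_chain s s c' -> c' = [::].
    by move/(maximal_chain_rk rk_rank); case: c' => //= *; lia.
  exists [::]; split=> [||c' /nil_chain|c' /nil_chain->] //.
  by rewrite /maximal_chain /=.
have st : covered s t.
  by rewrite (coveredE rk_rank) eqn_leq le_rk (rk_lt rk_rank) //= ltW.
have one_chain c' : maximal_chain s t c' -> c' = [:: t].
  move=> c'_st; have := maximal_chain_rk rk_rank c'_st; move: c'_st.
  have := rk_lt rk_rank lt_st.
  case: c' => [|u [|v c']] /=; [lia| |lia].
  by move=> _ /andP[_ /= /eqP->].
exists [:: t]; split=> [||c' /one_chain|c' /one_chain->] //.
by rewrite /maximal_chain /= st eqxx.
Qed.

(** A maximal chain of an interval of rank two is given by its middle element,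
    so it suffices that u is an ascent while any other middle element is a
    descent with a larger lower label. *)
Lemma EL_interval_two s u t :
    covered s u -> covered u t -> lam s u <= lam u t ->
    (forall v, covered s v -> covered v t -> v != u ->
       lam s u < lam s v /\ lam v t < lam s v) ->
  EL_interval s t.
Proof.
move=> su ut le_su_ut v_desc.
have two_chain c' : maximal_chain s t c' ->
    exists v, [/\ c' = [:: v; t], covered s v & covered v t].
  move=> c'_st; have := maximal_chain_rk rk_rank c'_st; move: c'_st.
  move: (su) (ut); rewrite !(coveredE rk_rank).
  move=> /andP[/eqP rk_u _] /andP[/eqP rk_t _].
  case: c' => [|v [|w [|x c']]] /=; [lia|lia| |lia].
  by case/andP=> /and3P[sv vw _] /eqP /= e _; rewrite e in vw *; exists v.
exists [:: u; t]; split=> [||c' /two_chain[v [-> sv vt]]|c' /two_chain[v [-> sv vt]]].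
- by rewrite /maximal_chain /= su ut eqxx.
- by rewrite /= le_su_ut.
- have [-> //|/(v_desc v sv vt)[_ desc_v]] := eqVneq v u.
  by rewrite /= andbT leNgt desc_v.
- have [-> //|/(v_desc v sv vt)[lt_uv _]] := eqVneq v u.
  by rewrite [_ <= _]lexi_cons (ltW lt_uv) leNgt lt_uv.
Qed.

End EL.

(** * The labeling attached to an ordering of the atoms *)

Section Labeling.

Variables (d : Order.disp_t) (P : finTBPOrderType d) (rk : P -> nat) (xs : seq P).
Hypotheses (rk_rank : is_rank rk) (rk_top : rk \top = 3).
Hypothesis xs_atoms : atom_ordering rk xs.

Local Notation pos x := (index x xs).

(** The end of the edge above x that will get label 0; it is taken in icov(x)
    if possible, to make this edge a descent with respect to the label of x. *)
Definition first_cover x : P :=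
  if [pick y in icov rk xs (pos x)] is Some y then y
  else odflt \bot [pick y | covered x y].

(** The first atom has label 0, so that every edge above it is an ascent; the
    shift by #|P| leaves room below the label of a later atom for the labels of
    the edges into its icov. *)
Definition atom_label x : nat :=
  if pos x == 0%N then 0%N else (#|P| + pos x)%N.

(** The labels of the second kind are at most #|P|, hence below every label of
    an atom other than the first, and those of the third kind are above all
    labels of atoms; [enum_rank] only serves to keep them distinct. *)
Definition cover_label x y : nat :=
  if y == first_cover x then 0%N
  else if (pos x == 0%N) || (y \in icov rk xs (pos x))
  then (enum_rank y).+1 else (#|P| + #|P| + enum_rank y).+1.

Definition umel_label s t : nat :=
  if s == \bot then atom_label t
  else if rk s == 1%N then cover_label s t else 0%N.

Local Notation lam := umel_label.

Lemma mem_atoms x : (x \in xs) = (rk x == 1%N).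
Proof. by case: xs_atoms => _ ->. Qed.

Lemma mem_icov x y : rk x = 1%N ->
  (y \in icov rk xs (pos x)) =
    covered x y && has (fun x' => covered x' y) (take (pos x) xs).
Proof.
move=> rk_x; rewrite !inE nth_index ?mem_atoms ?rk_x //.
case xy: (covered x y); rewrite ?andbF //=.
by move: xy; rewrite (coveredE rk_rank) rk_x => /andP[-> _].
Qed.

Lemma icov0 : icov rk xs 0 = set0.
Proof. by apply/setP => y; rewrite !inE take0 /= !andbF. Qed.

Lemma first_cover_covered x : rk x = 1%N -> covered x (first_cover x).
Proof.
move=> rk_x; rewrite /first_cover; case: pickP => [y|_].
  by rewrite mem_icov // => /andP[].
case: pickP => [y //|no_y].
have [|y xy _] := @lt_covered _ P x \top; last by rewrite no_y in xy.
by rewrite lt_neqAle lex1 andbT; apply/eqP => e; rewrite e rk_top in rk_x.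
Qed.

Lemma pos_le x : (pos x <= #|P|)%N.
Proof.
case: xs_atoms => xs_uniq _.
by rewrite (leq_trans (index_size _ _)) // -(card_uniqP xs_uniq) max_card.
Qed.

Lemma atom_label_inj : {in xs &, injective atom_label}.
Proof.
move=> x y xxs yxs; rewrite /atom_label => e.
apply: (index_inj \bot xxs yxs); move: e => /=; move: (pos x) (pos y) => i j.
by do 2?case: ifP; lia.
Qed.

Lemma atom_label_lt x y : (pos x < pos y)%N -> atom_label x < atom_label y.
Proof.
rewrite /atom_label ltEnat /=; move: (pos x) (pos y) => i j.
by do 2?case: ifP; lia.
Qed.

Lemma cover_label_eq0 x y : (cover_label x y == 0%N) = (y == first_cover x).
Proof. by rewrite /cover_label; case: (y == _) => //; case: ifP. Qed.

Lemma cover_label_inj x : injective (cover_label x).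
Proof.
move=> y z.
have := ltn_ord (enum_rank y); have := ltn_ord (enum_rank z).
have inj_rank : enum_rank y = enum_rank z :> nat -> y = z.
  by move=> e; apply/enum_rank_inj/val_inj.
rewrite /cover_label; move: inj_rank.
move: (nat_of_ord (enum_rank y)) (nat_of_ord (enum_rank z)) => a b.
move: #|_| => n inj_ab.
have [->|_] := eqVneq y; have [->|_] := eqVneq z => //; do 2?case: ifP => //.
all: by move=> *; apply: inj_ab; lia.
Qed.

Lemma umel_label_inj s : {in covered s &, injective (lam s)}.
Proof.
have rk_up v : covered s v -> rk v = (rk s).+1.
  by rewrite (coveredE rk_rank) => /andP[/eqP].
move=> t u /rk_up rk_t /rk_up rk_u; rewrite /umel_label.
case: eqP => [s0|/eqP s_neq0]; last case: eqP => [_|rk_s].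
- have rk_s : rk s = 0%N by apply/eqP; rewrite (rk_eq0 rk_rank) s0.
  by apply: atom_label_inj; rewrite mem_atoms ?rk_t ?rk_u rk_s.
- exact: cover_label_inj.
move: s_neq0; rewrite -(rk_eq0 rk_rank) => /eqP rk_s0 _.
have := rk_le_top rk_rank t; have := rk_le_top rk_rank u; rewrite rk_top => ? ?.
have -> : t = \top by apply: (rk_eq_top rk_rank); lia.
by apply/esym/(rk_eq_top rk_rank); lia.
Qed.

Hypothesis icov_neq0 : forall i, (0 < i < size xs)%N -> icov rk xs i <> set0.

(** This is where the hypothesis on icov enters. *)
Lemma first_cover_icov x : rk x = 1%N -> (0 < pos x)%N ->
  first_cover x \in icov rk xs (pos x).
Proof.
move=> rk_x pos_x; rewrite /first_cover; case: pickP => // no_y.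
case: (@icov_neq0 (pos x)); first by rewrite pos_x index_mem mem_atoms rk_x.
by apply/setP => y; rewrite no_y inE.
Qed.

(** For the first atom both sides are false: its label is 0, and no atom comes
    before it. *)
Lemma cover_label_lt x y : rk x = 1%N ->
  (cover_label x y < atom_label x) = (y \in icov rk xs (pos x)).
Proof.
move=> rk_x; rewrite /cover_label /atom_label ltEnat /=.
have [pos_x|] := posnP (pos x); first by rewrite pos_x icov0 inE /= ltn0.
move=> pos_x; have [->|_] := eqVneq.
  by rewrite first_cover_icov // addn_gt0 pos_x orbT.
have := pos_le x; have := ltn_ord (enum_rank y).
move: pos_x (nat_of_ord _) => /=; move: (pos x) #|_| => i n pos_x k.
case: ifP; lia.
Qed.

Lemma des_bot x : rk x = 1%N -> des lam \bot x = #|icov rk xs (pos x)|.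
Proof.
move=> rk_x; rewrite (des_inj _ (@umel_label_inj _)); apply: eq_card => y.
rewrite inE {1}/umel_label -(rk_eq0 rk_rank) rk_x /= /umel_label eqxx.
by rewrite cover_label_lt // andb_idl // mem_icov // => /andP[].
Qed.

Lemma des_atom x y : rk x = 1%N -> covered x y ->
  des lam x y = (0 < cover_label x y)%N.
Proof.
move=> rk_x xy; rewrite (des_inj _ (@umel_label_inj _)).
have rk_y : rk y = 2%N by move: xy; rewrite (coveredE rk_rank) rk_x => /andP[/eqP].
have yu u : covered y u = (u == \top).
  rewrite (coveredE rk_rank) rk_y; apply/andP/eqP => [[/eqP rk_u _]|->].
    by apply: (rk_eq_top rk_rank); rewrite rk_top.
  by rewrite rk_top lex1.
have [pos_xy|le_xy] := ltnP 0 (cover_label x y); last first.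
  apply: eq_card0 => u; rewrite !inE /umel_label -!(rk_eq0 rk_rank) rk_x rk_y /=.
  by rewrite ltEnat /= ltnNge le_xy andbF.
transitivity #|[set \top : P]|; last by rewrite cards1.
apply: eq_card => u; rewrite !inE /umel_label -!(rk_eq0 rk_rank) rk_x rk_y /=.
by rewrite ltEnat /= pos_xy yu andbT.
Qed.

Lemma des_coatom s t : (1 < rk s)%N -> covered s t -> des lam s t = 0%N.
Proof.
move=> rk_s st; rewrite (des_inj _ (@umel_label_inj _)); apply: eq_card0 => u.
rewrite !inE; apply/negP => /andP[+ _]; move: st; rewrite !(coveredE rk_rank).
have := rk_le_top rk_rank u; rewrite rk_top; lia.
Qed.

Hypothesis icov_mono : forall i j, (i <= j < size xs)%N ->
  (#|icov rk xs i| <= #|icov rk xs j|)%N.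

Lemma ind_le_label s t u : covered s t -> covered s u ->
  (ind lam s t <= ind lam s u)%N -> lam s t <= lam s u.
Proof.
move=> st su; rewrite !(ind_inj (@umel_label_inj s)) // ltnS; apply: contraTT.
rewrite -ltNge -ltnNge => lt_ut; apply/proper_card/properP; split.
  apply/subsetP => v; rewrite !inE => /andP[-> lt_vu]; exact: lt_trans lt_ut.
by exists u; rewrite !inE su ?lt_ut ?ltxx.
Qed.

(** Taken in both directions this is uniform descent, and it contains
    monotonicity. At the bottom, a larger index is a later atom, whose icov is
    at least as large. Above atoms, the descent number is 0 for index 1 and 1
    otherwise. *)
Lemma des_mono s t s' t' : rk s = rk s' -> covered s t -> covered s' t' ->
  (ind lam s t <= ind lam s' t')%N -> (des lam s t <= des lam s' t')%N.
Proof.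
move=> rk_ss st st'.
have [rk_s|] := posnP (rk s).
  have s0 : s = \bot by apply/eqP; rewrite -(rk_eq0 rk_rank) rk_s.
  have s'0 : s' = \bot by apply/eqP; rewrite -(rk_eq0 rk_rank) -rk_ss rk_s.
  rewrite {}s0 {}s'0 in st st' rk_s rk_ss * => /(ind_le_label st st').
  rewrite /umel_label eqxx => le_tt'.
  have rk_t : rk t = 1%N.
    by move: st; rewrite (coveredE rk_rank) rk_s => /andP[/eqP].
  have rk_t' : rk t' = 1%N.
    by move: st'; rewrite (coveredE rk_rank) rk_s => /andP[/eqP].
  rewrite !des_bot //; apply: icov_mono; rewrite index_mem mem_atoms rk_t' andbT.
  by rewrite leqNgt; apply: contraL le_tt' => /atom_label_lt; rewrite -ltNge.
move=> rk_s_gt0; have [rk_s_gt1|rk_s_le1 le_ind] := ltnP 1 (rk s).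
  by rewrite !des_coatom // -rk_ss.
have rk_s : rk s = 1%N by lia.
have rk_s' : rk s' = 1%N by rewrite -rk_ss.
rewrite !des_atom //.
suff: cover_label s' t' == 0%N -> cover_label s t == 0%N by lia.
rewrite !cover_label_eq0 => /eqP t'E; move: le_ind; apply: contraLR => t_neq.
have ss0 : (s == \bot) = false by rewrite -(rk_eq0 rk_rank) rk_s.
have ss'0 : (s' == \bot) = false by rewrite -(rk_eq0 rk_rank) rk_s'.
rewrite -ltnNge !(ind_inj (@umel_label_inj _)) // ltnS.
(* No label is smaller than the label 0 of t', while the edge of label 0 above
   s is smaller than the edge to t. *)
rewrite [X in (X < _)%N]eq_card0 => [|u]; last first.
  rewrite !inE /umel_label ss'0 rk_s' ltEnat /=.
  by move: (cover_label_eq0 s' t'); rewrite t'E eqxx => /eqP ->; rewrite andbF.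
rewrite card_gt0; apply/set0Pn; exists (first_cover s).
rewrite inE first_cover_covered // /umel_label ss0 rk_s ltEnat /=.
move: (cover_label_eq0 s (first_cover s)); rewrite eqxx => /eqP ->.
by rewrite lt0n cover_label_eq0.
Qed.

(** Above an atom the unique ascent is its edge of label 0, since edges into the
    top are labeled 0. Below a rank-two element it comes from the first atom
    below it. In the whole poset an increasing word has to be 0 0 0: the chain
    starts at the first atom, the only one with label 0, and continues along
    its edge of label 0. *)
Lemma umel_label_EL : EL_labeling lam.
Proof.
move=> s t le_st; change (EL_interval lam s t).
have le_rk_t := rk_le_top rk_rank t; rewrite rk_top in le_rk_t.
have [|lt_rk] := leqP (rk t) (rk s).+1; first exact: EL_interval_short.
have [rk_s|rk_s_gt0] := posnP (rk s); last first.
  have rk_s : rk s = 1%N by lia.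
  have -> : t = \top by apply: (rk_eq_top rk_rank); rewrite rk_top; lia.
  have s0 : (s == \bot) = false by rewrite -(rk_eq0 rk_rank) rk_s.
  have label_up v : covered s v -> lam v \top = 0%N.
    rewrite (coveredE rk_rank) rk_s => /andP[/eqP rk_v _].
    by rewrite /umel_label -(rk_eq0 rk_rank) rk_v.
  have sy := first_cover_covered rk_s.
  have label_y : lam s (first_cover s) = 0%N.
    by apply/eqP; rewrite /umel_label s0 rk_s cover_label_eq0.
  apply: (EL_interval_two rk_rank sy); rewrite ?label_y ?label_up //.
    move: sy; rewrite !(coveredE rk_rank) rk_s rk_top => /andP[/eqP-> _].
    by rewrite lex1.
  move=> v sv _ v_neq; rewrite label_up //.
  by rewrite /umel_label s0 rk_s ltEnat /= lt0n cover_label_eq0.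
have s0 : s = \bot by apply/eqP; rewrite -(rk_eq0 rk_rank) rk_s.
rewrite {}s0 in rk_s lt_rk le_st *.
have bot_t : \bot < t.
  rewrite lt_neqAle le0x andbT eq_sym -(rk_eq0 rk_rank) -lt0n.
  exact: leq_ltn_trans lt_rk.
have [u bot_u le_ut] := lt_covered bot_t.
have bot_covered v : covered \bot v = (rk v == 1%N).
  by rewrite (coveredE rk_rank) le0x andbT (proj1 rk_rank).
have label_bot v : lam \bot v = atom_label v by rewrite /umel_label eqxx.
have label_atom v w : rk v = 1%N -> lam v w = cover_label v w.
  by move=> rk_v; rewrite /umel_label -(rk_eq0 rk_rank) rk_v.
have rk_u : rk u = 1%N by apply/eqP; rewrite -bot_covered.
have uxs : u \in xs by rewrite mem_atoms rk_u.
have [xs_uniq _] := xs_atoms.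
have [le_rk|rk_t] := leqP (rk t) 2.
  have rk_t : rk t = 2%N by lia.
  have has_t : has (fun x => covered x t) xs.
    by apply/hasP; exists u => //; rewrite (coveredE rk_rank) rk_t rk_u le_ut.
  have lt_find := has_t; rewrite has_find in lt_find.
  set x := nth \bot xs (find (fun x => covered x t) xs).
  have pos_x : pos x = find (fun x => covered x t) xs by apply: index_uniq.
  have xxs : x \in xs by apply: mem_nth.
  have rk_x : rk x = 1%N by apply/eqP; rewrite -mem_atoms.
  have xt : covered x t := nth_find \bot has_t.
  have bot_x : covered \bot x by rewrite bot_covered rk_x.
  apply: (EL_interval_two rk_rank bot_x xt).
    rewrite label_bot label_atom // leNgt cover_label_lt // mem_icov // xt /=.
    by rewrite pos_x has_take_leq ?find_size // ltnn.
  move=> v; rewrite bot_covered => /eqP rk_v vt v_neq.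
  have lt_xv : (pos x < pos v)%N.
    rewrite ltn_neqAle pos_x; apply/andP; split.
      rewrite -pos_x; apply: contraNneq v_neq => e.
      by rewrite -(index_inj \bot xxs _ e) // mem_atoms rk_v.
    rewrite leqNgt; apply/negP => /(before_find \bot).
    by rewrite nth_index ?vt // mem_atoms rk_v.
  rewrite !label_bot label_atom // atom_label_lt //; split=> //.
  rewrite cover_label_lt // mem_icov // vt /=.
  by rewrite has_take_leq ?index_size // -pos_x.
have -> : t = \top by apply: (rk_eq_top rk_rank); rewrite rk_top; lia.
move=> {t le_rk_t bot_t le_st le_ut lt_rk rk_t}.
have xs_gt0 : (0 < size xs)%N by case: (xs) uxs.
set x := nth \bot xs 0.
have pos_x : pos x = 0%N by apply: index_uniq.
have xxs : x \in xs by apply: mem_nth.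
have rk_x : rk x = 1%N by apply/eqP; rewrite -mem_atoms.
have three_chain c' : maximal_chain \bot \top c' -> exists v w,
    [/\ c' = [:: v; w; \top], rk v = 1%N, covered v w & lam w \top = 0%N].
  move=> c'_st; have := maximal_chain_rk rk_rank c'_st; move: c'_st.
  rewrite rk_top (proj1 rk_rank) /maximal_chain.
  case: c' => [|v [|w [|z [|z' c']]]] //=.
  rewrite bot_covered => /andP[/and4P[/eqP rk_v vw _ _] /eqP->] _.
  exists v, w; split=> //; move: vw.
  rewrite (coveredE rk_rank) rk_v => /andP[/eqP rk_w _].
  by rewrite /umel_label -(rk_eq0 rk_rank) rk_w.
have xy := first_cover_covered rk_x.
have rk_y : rk (first_cover x) = 2%N.
  by move: xy; rewrite (coveredE rk_rank) rk_x => /andP[/eqP].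
have word0 : label_word lam \bot [:: x; first_cover x; \top] = [:: 0%N; 0%N; 0%N].
  rewrite /= label_bot label_atom // /atom_label pos_x /=.
  rewrite /umel_label -(rk_eq0 rk_rank) rk_y /=.
  by have /eqP-> : cover_label x (first_cover x) == 0%N by rewrite cover_label_eq0.
exists [:: x; first_cover x; \top]; rewrite word0; split=> //.
- rewrite /maximal_chain /= bot_covered rk_x xy !eqxx andbT /=.
  by rewrite (coveredE rk_rank) rk_top rk_y lex1.
- move=> c' /three_chain[v [w [-> rk_v vw label_w]]].
  rewrite /= label_bot label_atom // label_w andbT !leEnat leqn0 cover_label_eq0.
  case/andP=> + /eqP w_first; rewrite w_first.
  have /eqP-> : cover_label v (first_cover v) == 0%N by rewrite cover_label_eq0.
  rewrite leqn0 /atom_label; case: (pos v =P 0%N) => [pos_v _|];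
    last by case: (pos v) => // i _; rewrite addnS.
  by rewrite (index_inj \bot _ xxs (etrans pos_v (esym pos_x))) // mem_atoms rk_v.
- move=> c' /three_chain[v [w [-> _ _ label_w]]].
  rewrite /= label_w; do 2![rewrite [_ <= _]lexi_cons le0x; apply/implyP => _].
  by rewrite lexx.
Qed.

(** If no edge has index j the value of [des_rank] at j is the default 0; the
    bound on j excludes this, because each label above an element is attained. *)
Lemma umel_label_monotonic : monotonic rk lam.
Proof.
move=> k i j lt_k i_gt0 le_ij le_j; rewrite /des_rank.
case: pickP => //= -[s t] /= /and3P[/eqP rk_s st /eqP ind_st].
have j_gt0 := leq_trans i_gt0 le_ij.
case: pickP => [[s' t'] /= /and3P[/eqP rk_s' st' /eqP ind_st']|no_j].
  by apply: des_mono; rewrite ?rk_s ?rk_s' ?ind_st ?ind_st'.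
move: le_j; rewrite /num_labels; case: pickP => [s' /eqP rk_s'|]; last by lia.
move=> le_j; have lt_j : (j.-1 < size (labels_above lam s'))%N by rewrite prednK.
have /labels_aboveP[t' st' def_t'] := mem_nth (lam s' s') lt_j.
have := no_j (s', t'); rewrite /= rk_s' st' eqxx /ind -def_t' index_uniq //.
  by rewrite prednK ?eqxx.
by rewrite sort_uniq undup_uniq.
Qed.

End Labeling.

Local Close Scope order_scope.

(** * UMEL-shellability *)

Theorem theorem6p5 (d : Order.disp_t) (P : finTBPOrderType d) (rk : P -> nat)
  (rk_rank : is_rank rk)
  (rk_top : rk Order.top = 3)
  (P_unif : rank_uniform rk)
  (icov_neq0 : forall xs : seq P, atom_ordering rk xs ->
     forall i : nat, 1 <= i < size xs -> icov rk xs i <> set0) :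
  UMEL_shellable rk.
Proof.
(* The size of icov(x) if p lists the atoms that precede x. *)
pose icov_size (p : seq P) x :=
  #|[set y | [&& rk y == 2, covered x y & has (fun x' => covered x' y) p]]|.
have icov_size_mono p q x : {subset p <= q} -> icov_size p x <= icov_size q x.
  move=> p_q; apply/subset_leq_card/subsetP => y; rewrite !inE.
  case/and3P=> -> -> /hasP[x' /p_q x'_q x'y] /=.
  by apply/hasP; exists x'.
have [xs xs_perm icov_mono] :=
  greedy_sequence [seq x <- enum P | rk x == 1] icov_size_mono.
have xs_atoms : atom_ordering rk xs.
  split=> [|x].
    by rewrite (perm_uniq xs_perm) filter_uniq ?enum_uniq.
  by rewrite (perm_mem xs_perm) mem_filter mem_enum andbT.
have {}icov_neq0 := icov_neq0 xs xs_atoms.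
have {}icov_mono := icov_mono Order.bottom.
exists _, nat, (umel_label rk xs); split; last exact: umel_label_monotonic.
split; first exact: umel_label_EL.
- move=> s s' i rk_ss' _.
  have lam_inj := umel_label_inj rk_rank rk_top xs_atoms.
  rewrite !(width_inj (lam_inj _)) -!(W1E rk_rank).
  by rewrite (P_unif s s' 1 rk_ss').
- move=> s t s' t' rk_ss' st st' ind_eq; apply/eqP; rewrite eqn_leq.
  by rewrite !(des_mono rk_rank rk_top xs_atoms) ?ind_eq.
Qed.
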